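(* There is a function $L:\mathbb{Z}\rightarrow\mathbb{Z}$ such that, for every positive integer $k$, if $G$ is a graph and $S,T\subseteq V(G)$ are disjoint sets with $\kappa_G(S,T)\ge L(k)$ and $\sqcap_G(S,T)<k$, then there exists a graph $\tilde G$ that is locally equivalent to $G$ such that $\tilde G[S\cup T]=G[S\cup T]$ and $\tilde G$ has a $k$-link for $(S,T)$.
   Context: All graphs are finite and simple. For a vertex $v$ of a graph $G$, $G*v$ denotes the graph formed from $G$ by replacing the induced subgraph of $G$ on the set of neighbours of $v$ with its complement (local complementation at $v$). Two graphs are locally equivalent if one can be obtained from the other by a sequence of local complementations. $G[X]$ denotes the subgraph of $G$ induced on $X$. Let $A$ be the adjacency matrix of $G$. The cut-rank $\rho_G(X)$ of $X\subseteq V(G)$ is the rank over $\mathrm{GF}(2)$ of the submatrix of $A$ with rows $X$ and columns $V(G)\setminus X$. For disjoint sets $S,T\subseteq V(G)$: - the local connectivity $\sqcap_G(S,T)$ (also written $\sqcap(S,T)$) is the rank over $\mathrm{GF}(2)$ of the submatrix $A[S,T]$ with rows $S$ and columns $T$; - the connectivity $\kappa_G(S,T)$ is the minimum of $\rho_G(X)$ over all sets $X$ with $S\subseteq X\subseteq V(G)\setminus T$. For $T\subseteq V(G)$, a set $I\subseteq V(G)\setminus T$ is called $T$-independent if $|I|=\sqcap_G(T,I)$. A $k$-link for $(S,T)$ in a graph $G$ is a pair $(X_1,X_2)$ of $k$-element subsets of $V(G)\setminus(S\cup T)$ such that $X_1$ is $S$-independent, $X_2$ is $T$-independent, and either (1)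 $X_1=X_2$, or (2) $X_1$ and $X_2$ are disjoint, $\sqcap_G(X_1,X_2)=k$, all vertices in $X_1$ have the same set of neighbours in $T$, and all vertices in $X_2$ have the same set of neighbours in $S$. *)

(* Defs.v *)
From mathcomp Require Import all_boot all_order all_algebra.

Set Implicit Arguments.
Unset Strict Implicit.
Unset Printing Implicit Defensive.

Import GRing.Theory.

Record sgraph (V : finType) := SGraph {
  adj :> rel V;
  adj_sym : symmetric adj;
  adj_irr : irreflexive adj }.

Section Graphs.

Variable V : finType.
Implicit Types (G H : sgraph V) (S T X I : {set V}) (v x y : V) (k : nat).

Definition nbhd G v : {set V} := [set x | G v x].

Definition lc_adj G v : rel V := fun x y =>
  if [&& x != y, x \in nbhd G v & y \in nbhd G v] then ~~ G x y else G x y.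

Lemma lc_adj_sym G v : symmetric (lc_adj G v).
Proof.
by move=> x y; rewrite /lc_adj eq_sym (adj_sym G x) [(x \in _) && _]andbC.
Qed.

Lemma lc_adj_irr G v : irreflexive (lc_adj G v).
Proof. by move=> x; rewrite /lc_adj eqxx adj_irr. Qed.

(* The graph written G * v in the literature. *)
Definition local_compl G v : sgraph V :=
  SGraph (@lc_adj_sym G v) (@lc_adj_irr G v).

(* Adjacency relations are compared pointwise, so that no extensionality axiom
   is needed to identify two presentations of the same labelled graph. *)
Definition locally_equivalent G H : Prop :=
  exists vs : seq V, H =2 foldl local_compl G vs.

(* The submatrix A[S, T] of the adjacency matrix A over GF(2); rows and columns
   follow the enumerations of S and T. *)
Definition adj_submx G S T : 'M['F_2]_(#|S|, #|T|) :=
  (\matrix_(i < #|S|, j < #|T|) (G (enum_val i) (enum_val j))%:R)%R.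

Definition cut_rank G X : nat := \rank (adj_submx G X (~: X)).

Definition local_conn G S T : nat := \rank (adj_submx G S T).

(* For disjoint S and T the set S is itself a candidate, so the arg min is
   a genuine minimiser. *)
Definition connectivity G S T : nat :=
  cut_rank G [arg min_(X < S | (S \subset X) && (X \subset ~: T)) cut_rank G X].

Definition independent G T I : Prop :=
  I \subset ~: T /\ #|I| = local_conn G T I.

Definition is_link G k S T (X1 X2 : {set V}) : Prop :=
  [/\ X1 \subset ~: (S :|: T) /\ X2 \subset ~: (S :|: T),
      #|X1| = k /\ #|X2| = k,
      independent G S X1,
      independent G T X2
    & X1 = X2 \/
      [/\ [disjoint X1 & X2],
          local_conn G X1 X2 = k,
          {in X1 &, forall x y, nbhd G x :&: T = nbhd G y :&: T}
        & {in X2 &, forall x y, nbhd G x :&: S = nbhd G y :&: S}]].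

Definition has_link G k S T : Prop := exists X1 X2, is_link G k S T X1 X2.

End Graphs.

(* Main.v *)
Require Import Defs.
From mathcomp Require Import all_boot all_order all_algebra zify.

Set Implicit Arguments.
Unset Strict Implicit.
Unset Printing Implicit Defensive.

Import GRing.Theory.

(** Why it is true.  Write r(X, Y) for the rank over GF(2) of the adjacency
    submatrix with rows X and columns Y, and let U be a vertex set containing S
    and T such that every cut of G[U] separating S from T has rank at least m.

    Call v and w, both in U but outside S and T, twins when they have the same
    neighbours in S :|: T.  Twins can be reduced without touching G[S :|: T]:
    if they are not adjacent, the changes which G * v * w makes inside
    S :|: T cancel, and if they are adjacent the same holds for the pivot
    G * w * v * w ([lc_twins_nonadj], [lc_twins_adj]).  By submodularity of r,
    for each such v one of G - v and G * v - v keeps all the separating cuts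
    of rank at least m ([linked_delete]); hence v can be deleted either from G
    itself or from the graph just described ([twins_delete]).  Repeating this,
    one may assume that there are no twins in W = U \ (S :|: T).

    Take a maximal subset I of W that is both S-independent and T-independent.
    If I has at least k elements, any k of them form a link of the first kind.
    Otherwise every vertex of W is spanned by I with respect to S or with
    respect to T, so that W splits into Z and Z' with r(Z, S) < k and r(Z', T) < k
    ([common_rows_free_or_split]).  The cut between S :|: Z' and T :|: Z then
    forces r(Z', Z) to be at least m - 3k.  Choose X1 in Z' with independent
    rows towards Z.  There are at most 2^k neighbourhoods in T, so that a large
    part of X1 has a common one; its vertices, not being twins, have distinct
    neighbourhoods in S, so its rank towards S is at least the logarithm of its
    size ([ex_uniform_rows_free]).  Next choose in Z a set whose rows towards
    this S-independent set are independent, do the same on that side, and trim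
    both sets to size k: this is a link of the second kind
    ([twin_free_link]).  Taking a logarithm twice accounts for the double
    exponential in L(k) = 3k + 2^(k + 2^(2k)). *)

(** * Ranks of submatrices *)

Section SubmatrixRank.

Local Open Scope ring_scope.

Variables (F : fieldType) (V : finType).
Implicit Types (M : V -> V -> F) (W X Y Z I S T : {set V}).

(** Submatrices are encoded as matrices of fixed size with the other entries
    zeroed out, so that different index sets never give different types. *)
Definition selmx X : 'M[F]_#|V| := diag_mx (\row_i (enum_val i \in X)%:R).

Definition maskmx M X Y : 'M[F]_#|V| :=
  selmx X *m (\matrix_(i, j) M (enum_val i) (enum_val j)) *m selmx Y.

Definition rk M X Y : nat := \rank (maskmx M X Y).

Lemma maskmxE M X Y i j :
  maskmx M X Y i j = if (enum_val i \in X) && (enum_val j \in Y)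
                    then M (enum_val i) (enum_val j) else 0.
Proof.
rewrite /maskmx /selmx mul_diag_mx mul_mx_diag !mxE.
by case: (_ \in X); case: (_ \in Y); rewrite ?mul1r ?mulr1 ?mul0r ?mulr0.
Qed.

Lemma selmxM X Y : selmx X *m selmx Y = selmx (X :&: Y).
Proof.
rewrite /selmx mulmx_diag; congr diag_mx; apply/rowP => i.
by rewrite !mxE inE -natrM mulnb.
Qed.

Lemma selmx_sum_compl Y : selmx Y + selmx (~: Y) = 1%:M.
Proof.
rewrite -diag_const_mx /selmx -raddfD /=; congr diag_mx; apply/rowP => i.
by rewrite !mxE inE -natrD; case: (_ \in Y).
Qed.

Lemma selmx0 : selmx set0 = 0.
Proof. by apply/matrixP => i j; rewrite !mxE inE mul0rn. Qed.

Lemma selmxT : selmx setT = 1%:M.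
Proof. by rewrite -(selmx_sum_compl setT) setCT selmx0 addr0. Qed.

Lemma selmx_sub X Y : X \subset Y -> (selmx X <= selmx Y)%MS.
Proof. by move=> /setIidPl <-; rewrite -selmxM submxMl. Qed.

Lemma selmxI X Y : (selmx X :&: selmx Y <= selmx (X :&: Y))%MS.
Proof.
apply/rV_subP => u; rewrite sub_capmx => /andP[/submxP[a ua] /submxP[b ub]].
have uX : u *m selmx X = u by rewrite ua -mulmxA selmxM setIid.
have uY : u *m selmx Y = u by rewrite ub -mulmxA selmxM setIid.
by apply/submxP; exists u; rewrite -selmxM mulmxA uX uY.
Qed.

Lemma selmxU X Y : (selmx (X :|: Y) <= selmx X + selmx Y)%MS.
Proof.
have -> : selmx (X :|: Y) = selmx X + selmx (Y :\: X).
  rewrite /selmx -raddfD /=; congr diag_mx; apply/rowP => i.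
  by rewrite !mxE !inE -natrD; case: (_ \in X); case: (_ \in Y).
apply: addmx_sub; first exact: addsmxSl.
by apply: submx_trans (addsmxSr _ _); apply/selmx_sub/subsetDl.
Qed.

Lemma rank_selmx_modular X Y :
  (\rank (selmx X) + \rank (selmx Y) <=
   \rank (selmx (X :|: Y)) + \rank (selmx (X :&: Y)))%N.
Proof.
rewrite -mxrank_sum_cap leq_add ?mxrankS ?selmxI //.
by rewrite addsmx_sub !selmx_sub ?subsetUl ?subsetUr.
Qed.

Lemma eq_rk M N X Y : {in X & Y, M =2 N} -> rk M X Y = rk N X Y.
Proof.
move=> MN; congr (\rank _); apply/matrixP => i j; rewrite !maskmxE.
by case: ifP => // /andP[iX jY]; apply: MN.
Qed.

Lemma rk_tr M X Y : rk (fun x y => M y x) Y X = rk M X Y.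
Proof.
rewrite /rk -mxrank_tr; congr (\rank _); apply/matrixP => i j.
by rewrite mxE !maskmxE andbC.
Qed.

Lemma rk_mono M X X' Y Y' :
  X \subset X' -> Y \subset Y' -> (rk M X Y <= rk M X' Y')%N.
Proof.
move=> /setIidPl XX' /setIidPr YY'.
have -> : rk M X Y = \rank (selmx X *m maskmx M X' Y' *m selmx Y).
  by rewrite /maskmx !mulmxA selmxM -[X in _ = \rank X]mulmxA selmxM XX' YY'.
exact: leq_trans (mxrankM_maxl _ _) (mxrankM_maxr _ _).
Qed.

Lemma rk_submxE M X Y :
  rk M X Y =
  \rank (\matrix_(i < #|X|, j < #|Y|) M (enum_val i) (enum_val j)).
Proof.
set B := \matrix_(i < _, j < _) _.
pose h (Z : {set V}) (j : 'I_#|Z|) := enum_rank (enum_val j).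
pose P Z : 'M[F]_(#|Z|, #|V|) := rowsub (@h Z) 1%:M.
have BE N : mxsub (@h X) (@h Y) N = P X *m N *m (P Y)^T.
  rewrite /P trmx_mxsub trmx1 mul_rowsub_mx mulmx_colsub mul1mx mulmx1.
  by apply/matrixP => i j; rewrite !mxE.
have selP Z : (selmx Z <= P Z)%MS.
  apply/row_subP => i; rewrite /selmx row_diag_mx mxE.
  have [iZ|_] := boolP (_ \in Z); last by rewrite scale0r sub0mx.
  apply/submxP; exists (delta_mx 0 (enum_rank_in iZ (enum_val i))).
  by rewrite -rowE /P row_rowsub row1 scale1r /h enum_rankK_in // enum_valK.
apply/eqP; rewrite eqn_leq; apply/andP; split.
  have /submxP[a Xa] := selP X; have /submxP[b Yb] := selP Y.
  rewrite /rk; have -> : maskmx M X Y = a *m B *m b^T.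
    have -> : B = P X *m (\matrix_(i, j) M (enum_val i) (enum_val j)) *m (P Y)^T.
      by rewrite -BE; apply/matrixP => i j; rewrite !mxE !enum_rankK.
    rewrite !mulmxA -Xa -mulmxA -trmx_mul -Yb /maskmx; congr (_ *m _).
    by rewrite /selmx tr_diag_mx.
  exact: leq_trans (mxrankM_maxl _ _) (mxrankM_maxr _ _).
have -> : B = P X *m maskmx M X Y *m (P Y)^T.
  rewrite -BE; apply/matrixP => i j; rewrite [LHS]mxE [RHS]mxE maskmxE.
  by rewrite !enum_rankK !enum_valP.
exact: leq_trans (mxrankM_maxl _ _) (mxrankM_maxr _ _).
Qed.

Lemma rk_leq_card M X Y : (rk M X Y <= #|X|)%N.
Proof. by rewrite rk_submxE rank_leq_row. Qed.

(** Modulo the coordinates outside [Y], full rows are rows restricted to [Y].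
    This turns the rank of a submatrix into the dimension of a sum of subspaces,
    which is monotone in [X] and in the complement of [Y]. *)
Lemma rank_rows_compl M X Y :
  \rank (maskmx M X setT + selmx (~: Y))%MS = (rk M X Y + \rank (selmx (~: Y)))%N.
Proof.
have tailP : (maskmx M X (~: Y) <= selmx (~: Y))%MS by apply: submxMl.
have splitM : maskmx M X setT = maskmx M X Y + maskmx M X (~: Y).
  by rewrite /maskmx -mulmxDr selmx_sum_compl selmxT.
have /eqmxP -> : (maskmx M X setT + selmx (~: Y) ==
                  maskmx M X Y + selmx (~: Y))%MS.
  apply/andP; split; rewrite addsmx_sub addsmxSr andbT.
    rewrite splitM addmx_sub ?addsmxSl //.
    exact: submx_trans tailP (addsmxSr _ _).
  have -> : maskmx M X Y = maskmx M X setT - maskmx M X (~: Y).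
    by rewrite splitM addrK.
  rewrite addmx_sub ?addsmxSl // eqmx_opp.
  exact: submx_trans tailP (addsmxSr _ _).
apply: mxrank_disjoint_sum; apply/eqP; rewrite -submx0.
apply: submx_trans (capmxS (submxMl _ _) (submx_refl _)) _.
by apply: submx_trans (selmxI _ _) _; rewrite setICr selmx0.
Qed.

(** Submodularity of the dimension of subspaces, applied to the spaces of
    [rank_rows_compl]: the intersection of the two spaces contains, and their
    sum equals, a space of the same kind. *)
Lemma rk_submod M X1 X2 Y1 Y2 :
  (rk M (X1 :|: X2) (Y1 :&: Y2) + rk M (X1 :&: X2) (Y1 :|: Y2) <=
   rk M X1 Y1 + rk M X2 Y2)%N.
Proof.
set E := fun Y => \rank (selmx (~: Y)).
have E_modular : (E Y1 + E Y2 <= E (Y1 :&: Y2) + E (Y1 :|: Y2))%N.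
  by rewrite /E setCI setCU rank_selmx_modular.
suff : (rk M (X1 :|: X2) (Y1 :&: Y2) + E (Y1 :&: Y2) +
        (rk M (X1 :&: X2) (Y1 :|: Y2) + E (Y1 :|: Y2)) <=
        rk M X1 Y1 + E Y1 + (rk M X2 Y2 + E Y2))%N.
  by lia.
rewrite /E -!rank_rows_compl -[leqRHS]mxrank_sum_cap.
apply: leq_add; apply: mxrankS.
  rewrite addsmx_sub; apply/andP; split.
    have maskmxU : (maskmx M (X1 :|: X2) setT
                    <= maskmx M X1 setT + maskmx M X2 setT)%MS.
      rewrite /maskmx selmxT !mulmx1 -addsmxMr; apply: submxMr.
      exact: selmxU.
    exact: submx_trans maskmxU (addsmxS (addsmxSl _ _) (addsmxSl _ _)).
  rewrite setCI; apply: submx_trans (selmxU _ _) _.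
  by rewrite addsmxS ?addsmxSr.
rewrite addsmx_sub setCU; apply/andP; split.
  by rewrite sub_capmx /maskmx selmxT !mulmx1 !(submx_trans _ (addsmxSl _ _))
    ?submxMr ?selmx_sub ?subsetIl ?subsetIr.
by rewrite sub_capmx !(submx_trans _ (addsmxSr _ _)) ?selmx_sub
  ?subsetIl ?subsetIr.
Qed.

Local Close Scope ring_scope.

Lemma rkUl M X1 X2 Y : rk M (X1 :|: X2) Y <= rk M X1 Y + rk M X2 Y.
Proof.
have := rk_submod M X1 X2 Y Y; rewrite setIid; apply: leq_trans.
exact: leq_addr.
Qed.

Lemma rkUr M X Y1 Y2 : rk M X (Y1 :|: Y2) <= rk M X Y1 + rk M X Y2.
Proof. by rewrite -!(rk_tr M) rkUl. Qed.

(** Submodularity adds the elements of [Z] one at a time: the intersection of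
    the two row sets always contains [I]. *)
Lemma rk_span M I Z Y :
  {in Z, forall z, rk M (z |: I) Y <= rk M I Y} -> rk M (I :|: Z) Y <= rk M I Y.
Proof.
elim: {Z}#|Z| {-2}Z (erefl #|Z|) => [|n IHn] Z cardZ spanZ.
  by rewrite (cards0_eq cardZ) setU0.
have /card_gt0P[z zZ] : 0 < #|Z| by rewrite cardZ.
have cardZz : #|Z :\ z| = n by move: cardZ; rewrite (cardsD1 z Z) zZ => -[].
have {IHn} := IHn _ cardZz (fun y yZ => spanZ y (subsetP (subsetDl _ _) y yZ)).
have := spanZ z zZ.
have := rk_submod M (I :|: Z :\ z) (z |: I) Y Y; rewrite setIid setUid.
have -> : I :|: Z :\ z :|: (z |: I) = I :|: Z.
  by rewrite setUCA setUAC setUid -[I in _ |: I]setUC setUA setD1K // setUC.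
have : rk M I Y <= rk M ((I :|: Z :\ z) :&: (z |: I)) Y.
  by apply: rk_mono; rewrite // subsetI subsetUl subsetUr.
by lia.
Qed.

Definition rows_free M X Y := rk M X Y == #|X|.

Lemma rows_free0 M Y : rows_free M set0 Y.
Proof. by rewrite /rows_free cards0 -leqn0 -(cards0 V) rk_leq_card. Qed.

Lemma rows_freeW M X X' Y Y' :
  X' \subset X -> Y \subset Y' -> rows_free M X Y -> rows_free M X' Y'.
Proof.
move=> X'X YY' /eqP XY.
have := rkUl M X' (X :\: X') Y; rewrite -{1}(setIidPr X'X) setID XY.
rewrite -(cardsID X' X) (setIidPr X'X) /rows_free eqn_leq rk_leq_card /=.
have := rk_leq_card M (X :\: X') Y; have := rk_mono M (subxx X') YY'.
by lia.
Qed.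

Lemma rows_freeU1 M x X Y :
  rows_free M X Y -> rk M X Y < rk M (x |: X) Y -> rows_free M (x |: X) Y.
Proof.
move=> /eqP XY; rewrite XY /rows_free eqn_leq rk_leq_card /=; apply: leq_trans.
by rewrite cardsU1; case: (x \notin X).
Qed.

Lemma ex_basis M X Y :
  exists2 B : {set V}, B \subset X & rows_free M B Y /\ #|B| = rk M X Y.
Proof.
pose P (B : {set V}) := (B \subset X) && rows_free M B Y.
have /ex_maxset[B /maxsetP[/andP[BX Bfree] Bmax]] : exists B, P B.
  by exists set0; rewrite /P sub0set rows_free0.
exists B => //; split=> //; apply/eqP; rewrite -(eqP Bfree) eqn_leq rk_mono //=.
rewrite -[X in rk M X _](setUidPr BX); apply: rk_span => x xX.
rewrite leqNgt; apply/negP => lt_x; move: (lt_x); rewrite (Bmax (x |: B)) ?ltnn //.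
  by rewrite /P subUset sub1set xX BX rows_freeU1.
exact: subsetUr.
Qed.

Lemma ex_subset_card X n :
  n <= #|X| -> exists2 A : {set V}, A \subset X & #|A| = n.
Proof.
rewrite -bin_gt0 -cards_draws => /card_gt0P[A]; rewrite inE => /andP[AX /eqP].
by exists A.
Qed.

(** A cheap substitute for matroid intersection.  If a maximal common
    independent set of the two row matroids has fewer than [k] elements, each
    remaining row is spanned by it in one of the two matroids, and sorting the
    rows accordingly gives [Z]. *)
Lemma common_rows_free_or_split M W S T k :
  (exists2 I : {set V}, I \subset W
     & [/\ #|I| = k, rows_free M I S & rows_free M I T]) \/
  (exists2 Z : {set V}, Z \subset W & rk M Z S < k /\ rk M (W :\: Z) T < k).
Proof.
pose P (I : {set V}) := [&& I \subset W, rows_free M I S & rows_free M I T].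
have /ex_maxset[I /maxsetP[/and3P[IW IS IT] Imax]] : exists I, P I.
  by exists set0; rewrite /P sub0set !rows_free0.
have [/ex_subset_card[J JI cardJ]|ltIk] := leqP k #|I|; [left|right].
  exists J; first exact: subset_trans IW.
  by split=> //; [move: IS|move: IT]; apply: rows_freeW.
pose Z := [set v in W | rk M (v |: I) S <= rk M I S].
have spanned Y R :
    rows_free M I R -> {in Y, forall v, rk M (v |: I) R <= rk M I R} ->
    rk M Y R < k.
  move=> /eqP IR /rk_span; rewrite IR => le_I.
  apply: leq_ltn_trans ltIk; apply: leq_trans le_I.
  by rewrite rk_mono ?subsetUr.
exists Z; first by apply/subsetP => v; rewrite inE => /andP[].
split; apply: spanned => // v; rewrite !inE; first by case/andP.
case/andP=> + vW; rewrite vW /= -ltnNge => ltS; rewrite leqNgt; apply/negP => ltT.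
move: (ltS); rewrite (Imax (v |: I)) ?ltnn ?subsetUr //.
by rewrite /P subUset sub1set vW IW !rows_freeU1.
Qed.

End SubmatrixRank.

(** * Cut-rank, local complementation and deletion *)

Section Graphs.

Variable V : finType.
Implicit Types (G H : sgraph V) (P S T U W X Y Z : {set V}) (u v w x y : V).

Definition gmat G x y : 'F_2 := ((G x y)%:R)%R.

Lemma F2_addxx (a : 'F_2) : (a + a = 0)%R.
Proof. by case: a => [[|[|[]]] //] i; apply: val_inj. Qed.

Lemma local_connE G X Y : local_conn G X Y = rk (gmat G) X Y.
Proof. by rewrite rk_submxE. Qed.

Lemma gmatC G x y : gmat G x y = gmat G y x.
Proof. by rewrite /gmat adj_sym. Qed.

Lemma rkC G X Y : rk (gmat G) X Y = rk (gmat G) Y X.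
Proof. by rewrite -rk_tr; apply: eq_rk => x y _ _; rewrite gmatC. Qed.

Lemma gmat_lc G v x y : x != y ->
  (gmat (local_compl G v) x y = gmat G x y + gmat G v x * gmat G v y)%R.
Proof.
move=> xy; rewrite /gmat /= /lc_adj !inE xy /=.
by case: (G x y); case: (G v x); case: (G v y); apply: val_inj.
Qed.

Lemma mul_col_rowE (R : nzRingType) m n (c : 'cV[R]_m) (r : 'rV[R]_n) i j :
  ((c *m r) i j = c i 0 * r 0 j)%R.
Proof. by rewrite mxE big_ord1. Qed.

Lemma rk_row_operation (F : fieldType) (M N : V -> V -> F) (c : V -> F) v X Y :
  v \in X -> {in X & Y, forall x y, N x y = M x y + c x * M v y}%R ->
  rk N X Y <= rk M X Y.
Proof.
move=> vX NM.
pose d : 'cV[F]_#|V| :=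
  (\col_i (if enum_val i \in X then c (enum_val i) else 0))%R.
have -> : rk N X Y =
    \rank ((1%:M + d *m delta_mx 0 (enum_rank v)) *m maskmx M X Y)%R.
  congr (\rank _); apply/matrixP => i j.
  rewrite mulmxDl mul1mx -mulmxA -rowE [RHS]mxE mul_col_rowE.
  rewrite [X in (_ + X * _)%R]mxE [X in (_ + _ * X)%R]mxE.
  rewrite !maskmxE enum_rankK vX /=.
  case: ifP => [/andP[iX jY]|/negbT]; first by rewrite iX jY NM.
  rewrite negb_and => /orP[/negbTE->|/negbTE->]; first by rewrite mul0r addr0.
  by rewrite mulr0 addr0.
exact: mxrankM_maxr.
Qed.

(** Across a cut, local complementation at [v] adds row [v] to the rows of the
    neighbours of [v]; over GF(2) this row operation is its own inverse. *)
Lemma rk_lc_l G v X Y :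
  [disjoint X & Y] -> v \in X ->
  rk (gmat (local_compl G v)) X Y = rk (gmat G) X Y.
Proof.
move=> dXY vX; have neq x y : x \in X -> y \in Y -> x != y.
  by move=> xX yY; apply: contraTneq xX => ->; rewrite (disjointFl dXY yY).
have Gvv : gmat G v v = 0%R by rewrite /gmat adj_irr.
have lcv y : y \in Y -> gmat (local_compl G v) v y = gmat G v y.
  by move=> yY; rewrite gmat_lc ?neq // Gvv mul0r addr0.
apply/eqP; rewrite eqn_leq.
apply/andP; split; apply: (@rk_row_operation _ _ _ (gmat G v) v) => // x y xX yY.
  by rewrite gmat_lc ?neq.
by rewrite lcv // gmat_lc ?neq // -addrA F2_addxx addr0.
Qed.

Lemma rk_lc G v X Y :
  [disjoint X & Y] -> v \in X :|: Y ->
  rk (gmat (local_compl G v)) X Y = rk (gmat G) X Y.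
Proof.
move=> dXY; rewrite inE => /orP[vX|vY]; first exact: rk_lc_l.
by rewrite !(rkC _ X) rk_lc_l // disjoint_sym.
Qed.

(** The bound m <= kappa(S, T) in the subgraph induced on [U]; carrying [U]
    along instead of deleting vertices keeps all graphs on the type [V]. *)
Definition linked G U S T m :=
  [forall X : {set V},
    (S \subset X) && (X \subset U :\: T) ==> (m <= rk (gmat G) X (U :\: X))].

Lemma linkedP G U S T m :
  reflect (forall X : {set V}, S \subset X -> X \subset U :\: T ->
             m <= rk (gmat G) X (U :\: X))
          (linked G U S T m).
Proof.
apply: (iffP forallP) => [h X SX XU|h X].
  by have := h X; rewrite SX XU.
by apply/implyP => /andP[SX XU]; apply: h.
Qed.

Lemma linkedPn G U S T m : ~~ linked G U S T m ->
  exists X : {set V}, [/\ S \subset X, X \subset U :\: T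
                        & rk (gmat G) X (U :\: X) < m].
Proof.
rewrite negb_forall => /existsP[X p]; exists X.
by move: p; rewrite negb_imply -ltnNge => /andP[/andP[]].
Qed.

Lemma linked_lc G U S T m v :
  v \in U -> linked (local_compl G v) U S T m = linked G U S T m.
Proof.
move=> vU; apply: eq_forallb => X.
apply: implyb_id2l => /andP[_ XU]; congr (_ <= _); apply: rk_lc.
  by rewrite -setI_eq0 setIDA setIC setDIl setDv setI0.
by rewrite !inE vU andbT orbN.
Qed.

(** Put a 1 in the diagonal position of [v] and eliminate it: the Schur
    complement is the adjacency matrix of the local complement. *)
Lemma rk_schur G v X Y :
  v \notin X -> v \notin Y -> [disjoint X & Y] ->
  rk (fun x y => gmat G x y + ((x == v) && (y == v))%:R)%R (v |: X) (v |: Y)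
  <= (rk (gmat (local_compl G v)) X Y).+1.
Proof.
move=> vX vY dXY; set N := fun x y => _.
pose c : 'cV['F_2]_#|V| :=
  (\col_i (if enum_val i \in v |: X then N (enum_val i) v else 0))%R.
pose r : 'rV['F_2]_#|V| :=
  (\row_j (if enum_val j \in v |: Y then N v (enum_val j) else 0))%R.
have -> : rk N (v |: X) (v |: Y) =
    \rank (maskmx (gmat (local_compl G v)) X Y + c *m r)%R.
  congr (\rank _); apply/matrixP => i j.
  rewrite !maskmxE [RHS]mxE maskmxE mul_col_rowE [X in (_ + X * _)%R]mxE.
  rewrite [X in (_ + _ * X)%R]mxE.
  move: (enum_val i) (enum_val j) => x y; rewrite !in_setU1 /N.
  have Gvv : gmat G v v = 0%R by rewrite /gmat adj_irr.
  have [->|xv] /= := eqVneq x v.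
    by rewrite (negbTE vX) eqxx Gvv !add0r mul1r.
  have [->|yv] /= := eqVneq y v.
    by rewrite (negbTE vY) andbF !eqxx Gvv !add0r mulr1 andbT.
  have [xX|xX] := boolP (x \in X) => /=; last by rewrite add0r mul0r.
  have [yY|yY] := boolP (y \in Y) => /=; last by rewrite add0r mulr0.
  rewrite andbF !addr0 gmat_lc; last first.
    by apply: contraTneq xX => ->; rewrite (disjointFl dXY yY).
  by rewrite (gmatC G x v) -addrA F2_addxx addr0.
apply: leq_trans (mxrank_add _ _) _; rewrite -[leqRHS]addn1 leq_add2l.
exact: leq_trans (mxrankM_maxl _ _) (rank_leq_col _).
Qed.

(** If a cut [A] of G - v and a cut [B] of G * v - v both have rank below [m],
    add [v] to both sides of [B] by [rk_schur], at the price of one unit of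
    rank, and uncross it with [A]: this gives two separating cuts of G[U] whose
    ranks have sum at most 2 (m - 1) + 1, so that one of them is below [m]. *)
Lemma linked_delete G U S T m v :
  v \in U -> v \notin S -> v \notin T -> linked G U S T m ->
  linked G (U :\ v) S T m \/ linked (local_compl G v) (U :\ v) S T m.
Proof.
move=> vU vS vT /linkedP GU; apply/orP; apply: contraT.
rewrite negb_or => /andP[/linkedPn[A [SA AU ltA]] /linkedPn[B [SB BU ltB]]].
have sub X : X \subset U :\ v :\: T ->
    [/\ X \subset U, [disjoint X & T] & v \notin X].
  rewrite subsetD => /andP[/subsetD1P[XU vX] XT].
  by split.
have [[AsU AT vA] [BsU BT vB]] := (sub A AU, sub B BU).
have := @rk_schur G v B (U :\ v :\: B).
set N := fun x y => _.
(* The extra diagonal entry matters only if [v] is both a row and a column. *)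
have NE X Y : v \notin X :&: Y -> rk N X Y = rk (gmat G) X Y.
  move=> vXY; apply: eq_rk => x y xX yY; rewrite /N.
  case: andP => [[/eqP xv /eqP yv]|]; last by rewrite addr0.
  by case/negP: vXY; rewrite inE -{1}xv xX -yv yY.
have vBc : v \notin U :\ v :\: B by rewrite !inE eqxx andbF.
have dB : [disjoint B & U :\ v :\: B].
  by rewrite -setI_eq0 setIDA setIC setDIl setDv setI0.
move=> /(_ vB vBc dB).
have := rk_submod N A (v |: B) (U :\ v :\: A) (v |: (U :\ v :\: B)).
have vAc : v \notin U :\ v :\: A by rewrite !inE eqxx andbF.
rewrite (NE A); last by rewrite inE negb_and vAc orbT.
rewrite NE; last by rewrite !inE eqxx /= !andbF.
rewrite NE; last by rewrite !inE (negbTE vA).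
have -> : (U :\ v :\: A) :&: (v |: (U :\ v :\: B)) = U :\: (A :|: (v |: B)).
  apply/setP => x; rewrite !inE.
  by case: (x \in A); case: (x \in B); case: (x == v); case: (x \in U).
have -> : (U :\ v :\: A) :|: (v |: (U :\ v :\: B)) = U :\: (A :&: (v |: B)).
  apply/setP => x; rewrite !inE.
  have [->|_] := eqVneq x v; first by rewrite (negbTE vA) vU.
  by case: (x \in A); case: (x \in B); case: (x \in U).
have := GU (A :|: (v |: B)).
have := GU (A :&: (v |: B)).
rewrite !subsetD !subUset sub1set vU AsU BsU subsetI SA.
rewrite (subset_trans SB) ?subsetUr // (subset_trans (subsetIl _ _) AsU).
rewrite (subset_trans SA) ?subsetUl //.
have -> : [disjoint A :&: (v |: B) & T] by apply: disjointWl (subsetIl _ _) AT.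
have -> : [disjoint A :|: (v |: B) & T].
  by rewrite -setI_eq0 !setIUl !setU_eq0 !setI_eq0 AT BT disjoints1 vT.
move=> /(_ isT isT) geI /(_ isT isT) geU leS ltH.
have le2m := leq_trans (leq_add geU geI) leS.
have := leq_add ltA (leq_trans ltH ltB); rewrite addSn => lt2m.
by move: (leq_ltn_trans le2m lt2m); rewrite ltnn.
Qed.

(** * Deleting twins *)

Lemma lcE G v x y :
  local_compl G v x y = G x y (+) [&& x != y, G v x & G v y].
Proof. by rewrite /= /lc_adj !inE; case: ifP; rewrite ?addbT ?addbF. Qed.

(** The neighbourhood of [w] survives complementation at its non-neighbour [v],
    so the same pairs of [P] are toggled twice. *)
Lemma lc_twins_nonadj G v w P :
  v \notin P -> w \notin P -> v != w -> ~~ G v w ->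
  {in P, forall x, G v x = G w x} ->
  {in P &, local_compl (local_compl G v) w =2 G}.
Proof.
move=> vP wP vw Gvw tw x y xP yP; rewrite !lcE (negbTE Gvw) /= !andbF !addbF.
by rewrite !tw // -addbA addbb addbF.
Qed.

(** Complementing at [w] cuts [v] off from [P], so the middle step changes no
    pair inside [P] and leaves the neighbourhood of [w] in [P] as it was; the
    last step undoes the first one. *)
Lemma lc_twins_adj G v w P :
  v \notin P -> w \notin P -> v != w -> G v w ->
  {in P, forall x, G v x = G w x} ->
  {in P &, local_compl (local_compl (local_compl G w) v) w =2 G}.
Proof.
move=> vP wP vw Gvw tw x y xP yP.
have neq u z : u \notin P -> z \in P -> (u == z) = false.
  by move=> uP zP; apply: contraNF uP => /eqP ->.
rewrite !lcE !adj_irr (adj_sym G w v) Gvw (negbTE vw).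
rewrite (neq v x) // (neq v y) // (neq w x) // (neq w y) // !tw //=.
by case: (G x y); case: (G w x); case: (G w y); case: (x == y).
Qed.

(** When [v] cannot be deleted from [G], it can be deleted after a
    complementation at [v] by [linked_delete]; the other complementations, at the remaining
    vertex [w], do not affect cut-ranks and only serve to restore G[S :|: T]. *)
Lemma twins_delete G U S T m v w :
  S \subset U -> T \subset U ->
  v \in U :\: (S :|: T) -> w \in U :\: (S :|: T) -> v != w ->
  nbhd G v :&: (S :|: T) = nbhd G w :&: (S :|: T) ->
  linked G U S T m ->
  exists vs, let H := foldl (@local_compl V) G vs in
    {in S :|: T &, H =2 G} /\ linked H (U :\ v) S T m.
Proof.
move=> SU TU; rewrite in_setD => /andP[vP vU]; rewrite in_setD => /andP[wP wU] vw.
move=> /setP tw GU.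
have {}tw : {in S :|: T, forall x, G v x = G w x}.
  by move=> x xP; have := tw x; rewrite !inE !(andbC _ (_ || _)) -in_setU xP.
have wUv : w \in U :\ v by rewrite !inE eq_sym vw.
have [vS vT] : v \notin S /\ v \notin T by apply/andP; rewrite -negb_or -in_setU.
have [Gdel|Gdel] := boolP (linked G (U :\ v) S T m); first by exists [::].
have [Gvw|Gvw] := boolP (G v w).
  exists [:: w; v; w]; split; first exact: lc_twins_adj.
  rewrite [linked _ _ _ _ _](linked_lc _ _ _ _ wUv).
  have GwU : linked (local_compl G w) U S T m by rewrite (linked_lc _ _ _ _ wU).
  have [GwUv|] := linked_delete vU vS vT GwU; last exact.
  by case/negP: Gdel; rewrite -(linked_lc _ _ _ _ wUv); exact: GwUv.
exists [:: v; w]; split; first exact: lc_twins_nonadj.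
rewrite [linked _ _ _ _ _](linked_lc _ _ _ _ wUv).
have [GUv|] := linked_delete vU vS vT GU; last exact.
by case/negP: Gdel; exact: GUv.
Qed.

(** * Links in graphs without twins *)

(** The neighbourhoods are vectors of a row space over GF(2). *)
Lemma card_nbhd_types G X Y :
  #|[set nbhd G x :&: Y | x in X]| <= 2 ^ rk (gmat G) X Y.
Proof.
pose A := maskmx (gmat G) X Y.
pose g (u : 'rV['F_2]_(\rank A)) :=
  [set y in Y | ((u *m row_base A) 0 (enum_rank y) != 0)%R].
apply: (@leq_trans #|g @: setT|).
  apply/subset_leq_card/subsetP => _ /imsetP[x xX ->].
  have /submxP[u xu] : (row (enum_rank x) A <= row_base A)%MS.
    by rewrite (submx_trans (row_sub _ _)) // eq_row_base.
  apply/imsetP; exists u => //; apply/setP => y; rewrite !inE -xu [row _ _ _ _]mxE.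
  rewrite maskmxE !enum_rankK xX andbC /gmat; case: (y \in Y) => //=.
  by case: (G x y).
apply: leq_trans (leq_imset_card _ _) _.
by rewrite cardsT card_mx mul1n card_Fp.
Qed.

Lemma ex_large_fiber (aT rT : finType) (f : aT -> rT) (X : {set aT}) :
  exists2 X' : {set aT}, X' \subset X &
    {in X' &, forall x y : aT, f x = f y} /\ #|X| <= #|f @: X| * #|X'|.
Proof.
have [->|[x0 x0X]] := set_0Vmem X.
  by exists set0; rewrite ?sub0set // cards0; split=> // x; rewrite inE.
pose fib (x : aT) := [set x' in X | f x == f x'].
have [x xX xmax] := arg_maxnP (fun x : aT => #|fib x|) x0X.
exists (fib x); first by apply/subsetP => y; rewrite inE => /andP[].
split=> [y z|]; first by rewrite !inE => /andP[_ /eqP <-] /andP[_ /eqP].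
rewrite -sum1_card (partition_big_imset f) /= -sum_nat_const.
apply: leq_sum => _ /imsetP[y yX ->]; apply: leq_trans (xmax y yX).
rewrite sum1dep_card subset_leq_card //.
by apply/subsetP => z; rewrite !inE eq_sym.
Qed.

(** A largest class of vertices of [X] with equal neighbourhoods in [T] has at
    least #|X| / 2 ^ k elements; they are told apart by [S], so that their rank
    towards [S] is at least logarithmic, and a row basis is the required set. *)
Lemma ex_uniform_rows_free G X S T k :
  rk (gmat G) X T < k ->
  {in X &, forall x y,
     nbhd G x :&: (S :|: T) = nbhd G y :&: (S :|: T) -> x = y} ->
  exists2 X' : {set V}, X' \subset X &
    [/\ rows_free (gmat G) X' S, #|X| <= 2 ^ (k + #|X'|)
      & {in X' &, forall x y, nbhd G x :&: T = nbhd G y :&: T}].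
Proof.
move=> ltT tf.
have [X1 X1X [sameT leX]] := ex_large_fiber (fun x => nbhd G x :&: T) X.
have leX1 : #|X1| <= 2 ^ rk (gmat G) X1 S.
  rewrite -(card_in_imset (f := fun x => nbhd G x :&: S)) ?card_nbhd_types //.
  move=> x y xX1 yX1 xyS; apply: tf; try exact: (subsetP X1X).
  by rewrite !setIUr xyS (sameT x y).
have [B BX1 [Bfree cardB]] := ex_basis (gmat G) X1 S.
exists B; first exact: subset_trans X1X.
split=> //; last by move=> x y xB yB; apply: sameT; apply: (subsetP BX1).
apply: leq_trans leX _; rewrite cardB expnD leq_mul //.
by apply: leq_trans (card_nbhd_types _ _ _) _; rewrite leq_exp2l // ltnW.
Qed.

Lemma compl_side (U S T Z : {set V}) :
  [disjoint S & T] -> T \subset U -> Z \subset U :\: (S :|: T) ->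
  U :\: (S :|: U :\: (S :|: T) :\: Z) = T :|: Z.
Proof.
move=> dST TU ZW; apply/setP => x.
have := subsetP ZW x; have := subsetP TU x; have := @disjointFr _ _ _ x dST.
rewrite !inE; case: (x \in S); case: (x \in T); case: (x \in U);
  case: (x \in Z) => //= h1 h2 h3;
  by [move: (h1 isT)|move: (h2 isT)|move: (h3 isT)].
Qed.

(** The summand 3 k pays for the blocks (S, T), (S, Z) and (Z', T) of the cut;
    of the remaining rank, one application of [ex_uniform_rows_free] leaves
    2 ^ (2 * k) = 2 ^ (k + k), and a second one leaves [k]. *)
Lemma twin_free_link G U S T k :
  [disjoint S & T] -> S \subset U -> T \subset U ->
  linked G U S T (3 * k + 2 ^ (k + 2 ^ (2 * k))) ->
  rk (gmat G) S T < k ->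
  {in U :\: (S :|: T) &, forall x y,
     nbhd G x :&: (S :|: T) = nbhd G y :&: (S :|: T) -> x = y} ->
  has_link G k S T.
Proof.
move=> dST SU TU /linkedP GU ltST tf; set W := U :\: (S :|: T) in tf.
have out X :
    X \subset W -> [/\ X \subset ~: (S :|: T), X \subset ~: S & X \subset ~: T].
  move=> /subset_trans XW; split; apply: XW; apply/subsetP => x;
  by rewrite !inE negb_or => /andP[/andP[]]// *; apply/andP.
have indep X R : X \subset ~: R -> rows_free (gmat G) X R -> independent G R X.
  by move=> XR /eqP XRfree; split=> //; rewrite local_connE rkC.
have [[I IW [cardI IS IT]]|[Z ZW [ltZS ltZT]]] :=
    common_rows_free_or_split (gmat G) W S T k.
  have [IST IcS IcT] := out I IW; exists I, I.
  by split; [split|split|exact: indep IcS IS|exact: indep IcT IT|left].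
pose Z' := W :\: Z; have Z'W : Z' \subset W by apply: subsetDl.
have geZ : 2 ^ (k + 2 ^ (2 * k)) <= rk (gmat G) Z' Z.
  have := GU (S :|: Z') (subsetUl _ _).
  have -> : U :\: (S :|: Z') = T :|: Z by apply: compl_side.
  have -> : S :|: Z' \subset U :\: T.
    rewrite subUset subsetD SU dST; apply/subsetP => x /(subsetP Z'W).
    by rewrite !inE negb_or => /andP[/andP[_ ->]].
  have := rkUl (gmat G) S Z' (T :|: Z).
  have := rkUr (gmat G) S T Z; have := rkUr (gmat G) Z' T Z.
  rewrite (rkC G S Z).
  move: ltST ltZS ltZT; rewrite -/Z'; set e := 2 ^ _; set r := rk (gmat G).
  move: e (r _ _) (r S _) (r Z' _) (r Z' Z) (r Z' T) (r Z S) (r S T) => {r}.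
  by lia.
have tfW X : X \subset W ->
   {in X &, forall x y,
     nbhd G x :&: (S :|: T) = nbhd G y :&: (S :|: T) -> x = y}.
  by move=> XW x y xX yX; apply: tf; apply: (subsetP XW).
have [X1 X1Z' [X1Z cardX1]] := ex_basis (gmat G) Z' Z.
have X1W := subset_trans X1Z' Z'W.
have ltX1T : rk (gmat G) X1 T < k by apply: leq_ltn_trans ltZT; apply: rk_mono.
have [A1 A1X1 [A1S leX1 A1T]] := ex_uniform_rows_free ltX1T (tfW X1 X1W).
have leA1 : 2 ^ (2 * k) <= #|A1|.
  by rewrite -(leq_add2l k) -(leq_exp2l (m := 2)) // (leq_trans _ leX1) // cardX1.
(* The rank between [A1] and [Z] is #|A1|, so [A1] can be matched inside [Z]. *)
have [X2 X2Z [X2A1 cardX2]] := ex_basis (gmat G) Z A1.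
have {}cardX2 : #|X2| = #|A1|.
  by rewrite cardX2 rkC; apply/eqP; apply: rows_freeW A1X1 _ X1Z.
have X2W := subset_trans X2Z ZW.
have ltX2S : rk (gmat G) X2 S < k by apply: leq_ltn_trans ltZS; apply: rk_mono.
have [|A2 A2X2 [A2T leX2 A2S]] := ex_uniform_rows_free (k := k) (S := T) ltX2S.
  by rewrite setUC; apply: tfW.
have leA2 : k <= #|A2|.
  rewrite -(leq_add2l k) -(leq_exp2l (m := 2)) // (leq_trans _ leX2) // cardX2.
  by rewrite addnn -mul2n.
have [C2 C2A2 cardC2] := ex_subset_card leA2.
have C2A1 : rows_free (gmat G) C2 A1.
  exact: rows_freeW (subset_trans C2A2 A2X2) (subxx _) X2A1.
(* Trim [A1] back to the size of [C2], keeping the square block nonsingular. *)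
have [C1 C1A1 [C1C2 cardC1]] := ex_basis (gmat G) A1 C2.
have {}cardC1 : #|C1| = k by rewrite cardC1 rkC (eqP C2A1).
have C1Z' : C1 \subset Z' by rewrite (subset_trans C1A1) ?(subset_trans A1X1).
have C2Z : C2 \subset Z by rewrite (subset_trans C2A2) ?(subset_trans A2X2).
have [C1ST C1cS C1cT] := out C1 (subset_trans C1Z' Z'W).
have [C2ST C2cS C2cT] := out C2 (subset_trans C2Z ZW).
exists C1, C2; split; [by split|by split| | |].
- exact: indep C1cS (rows_freeW C1A1 (subxx _) A1S).
- exact: indep C2cT (rows_freeW C2A2 (subxx _) A2T).
right; split.
- apply: disjointWl C1Z' _; apply: disjointWr C2Z _.
  by rewrite disjoint_sym disjoints_subset setCD subsetUr.
- by rewrite local_connE (eqP C1C2).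
- by move=> x y xC yC; apply: A1T; apply: (subsetP C1A1).
- by move=> x y xC yC; apply: A2S; apply: (subsetP C2A2).
Qed.

Lemma linked_has_link G U S T k :
  [disjoint S & T] -> S \subset U -> T \subset U ->
  linked G U S T (3 * k + 2 ^ (k + 2 ^ (2 * k))) ->
  rk (gmat G) S T < k ->
  exists vs, let H := foldl (@local_compl V) G vs in
    {in S :|: T &, H =2 G} /\ has_link H k S T.
Proof.
move=> dST; have [n] := ubnP #|U|; elim: n U G => // n IHn U G ltU SU TU GU ltST.
set W := U :\: (S :|: T).
have [/existsP[v /existsP[w]]|] := boolP [exists v, exists w,
    [&& v \in W, w \in W, v != w &
     nbhd G v :&: (S :|: T) == nbhd G w :&: (S :|: T)]].
  case/and4P=> vW wW vw /eqP tw.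
  have [vs /= [HG HU]] := twins_delete SU TU vW wW vw tw GU.
  set H := foldl _ _ _ in HG HU.
  have [vS vT] : v \notin S /\ v \notin T.
    by move: vW; rewrite !inE negb_or => /andP[/andP[]].
  have vU : v \in U by move: vW; rewrite !inE => /andP[].
  have ltUv : #|U :\ v| < n by move: ltU; rewrite (cardsD1 v U) vU.
  have SUv : S \subset U :\ v by rewrite subsetD1 SU.
  have TUv : T \subset U :\ v by rewrite subsetD1 TU.
  have HST : rk (gmat H) S T = rk (gmat G) S T.
    by apply: eq_rk => x y xS yT; rewrite /gmat HG // inE ?xS ?yT ?orbT.
  have [|us /= [H'H H'link]] := IHn _ _ ltUv SUv TUv HU; first by rewrite HST.
  exists (vs ++ us); rewrite foldl_cat -/H; split; last exact: H'link.
  by move=> x y xST yST; rewrite H'H // HG.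
move=> /existsPn tf; exists [::]; split=> //; apply: twin_free_link GU _ _ => //.
move=> x y xW yW /eqP xy; have /existsPn/(_ y) := tf x.
by rewrite xW yW xy andbT /= negbK => /eqP.
Qed.

Lemma linked_connectivity G S T m :
  [disjoint S & T] -> m <= connectivity G S T -> linked G setT S T m.
Proof.
move=> dST le_m; apply/linkedP => X SX; rewrite !setTD => XT.
rewrite -local_connE; apply: leq_trans le_m _; rewrite /connectivity.
case: arg_minnP => [|Y _ minY]; first by rewrite subxx -disjoints_subset.
by apply: minY; rewrite SX.
Qed.

End Graphs.

Theorem lemma4p3 :
  exists L : int -> int,
    forall k : nat, 0 < k ->
    forall (V : finType) (G : sgraph V) (S T : {set V}),
      [disjoint S & T] ->
      (L k%:Z <= (connectivity G S T)%:Z)%R ->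
      local_conn G S T < k ->
      exists G' : sgraph V,
        [/\ locally_equivalent G G',
            {in S :|: T &, G' =2 G}
          & has_link G' k S T].
Proof.
exists (fun z : int => let k := `|z|%N in Posz (3 * k + 2 ^ (k + 2 ^ (2 * k)))).
(* The absolute value of the integer [k] reduces to the natural number [k]. *)
move=> k _ V G S T dST; rewrite lez_nat local_connE => geL ltST.
have GU := linked_connectivity dST geL.
have [vs /= [HG Hlink]] := linked_has_link dST (subsetT S) (subsetT T) GU ltST.
by exists (foldl (@local_compl V) G vs); split; first exists vs.
Qed.
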